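(* Let $R$ be a discrete valuation ring and let $A$ be a reduced countably generated torsion $R$-module with Ulm invariants $f=\{f_\alpha\}$ (indexed by ordinals $\alpha$). Let $H_f$ denote the set of sequences of the form $$\{h_n\}_{n\ge 0}=h_0,h_1,\dotsc,h_k,\infty,\infty,\dotsc$$ (the constant sequence $\infty,\infty,\dotsc$ being allowed), where $h_0<h_1<\dotsb<h_k$ are ordinals such that $f_{h_k}>0$ and such that whenever $h_n>h_{n-1}+1$ (with $1\le n\le k$), one has $f_{h_{n-1}}>0$. For $\{h_n\}$ and $\{h'_n\}$ in $H_f$, say that $\{h_n\}\leq\{h'_n\}$ if and only if $h_n\geq h'_n$ for all $n\geq 0$. Then taking an element of $A$ to its Ulm sequence gives rise to an isomorphism of the poset of automorphism orbits of elements of $A$ onto $H_f$.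
   Context: A module is reduced if it has no nonzero divisible submodule. Let $p$ be a generator of the maximal ideal of $R$. Define submodules $A_\alpha$ for ordinals $\alpha$ by $A_0=A$, $A_{\beta+1}=pA_\beta$, and $A_\alpha=\bigcap_{\beta<\alpha}A_\beta$ for limit ordinals $\alpha$. Ulm invariants: let $P(A)=\{a\in A\mid pa=0\}$ and $P(A)_\alpha=P(A)\cap A_\alpha$; the $\alpha$th Ulm invariant $f_\alpha=f_\alpha(A)$ is the dimension of $P(A)_\alpha/P(A)_{\alpha+1}$ over the residue field $R/pR$. Height: a nonzero $a\in A$ has height $h(a)=\alpha$ if $a\in A_\alpha$ and $a\notin A_{\alpha+1}$; and $h(0)=\infty$, where $\infty$ is a symbol greater than every ordinal. The Ulm sequence of $a\in A$ is $\{h_i\}_{i\geq 0}$ with $h_i=h(p^ia)$. The poset of automorphism orbits in $A$: its elements are the orbits in $A$ of the group of $R$-module automorphisms of $A$, ordered by degeneration, with the orbit of $b$ being $\leq$ the orbit of $a$ if and only if $a$ degenerates to $b$, i.e. there is an $R$-module endomorphism $\phi$ of $A$ with $\phi(a)=b$ (this is a well-defined partial order). *)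

(* Defs.v *)
From mathcomp Require Import all_boot all_algebra.
From mathcomp Require Import boolp classical_sets cardinality.

Set Implicit Arguments.
Unset Strict Implicit.
Unset Printing Implicit Defensive.

Import GRing.Theory.
Local Open Scope classical_set_scope.
Local Open Scope ring_scope.

(** * Ordinals *)

(** [Sup f] denotes the least ordinal strictly above all the [f i].  Every
    ordinal of the ambient universe has such a presentation, and two
    presentations denote the same ordinal when each is [preord_le] the other;
    [Ord] is the quotient, realised as the type of equivalence classes.  It
    carries no MathComp order structure on purpose: that would require a
    [choiceType], whose universe would then bound that of the index types [T],
    while these must be allowed to be as large as the modules below. *)
Inductive preord : Type := Sup (T : Type) (f : T -> preord).

Fixpoint preord_le (s t : preord) : Prop :=
  match s, t with
  | Sup T f, Sup U g => forall i : T, exists j : U, preord_le (f i) (g j)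
  end.

Definition preord_lt (s t : preord) : Prop :=
  match t with Sup U g => exists j : U, preord_le s (g j) end.

Definition preord_eqv (s t : preord) : Prop :=
  preord_le s t /\ preord_le t s.

Record Ord : Type := MkOrd {
  ord_class : preord -> Prop;
  ord_classP : exists t, ord_class = preord_eqv t }.

Definition ord_of (t : preord) : Ord :=
  MkOrd (ex_intro (fun u => preord_eqv t = preord_eqv u) t erefl).

Definition ord_repr (a : Ord) : preord := projT1 (cid (ord_classP a)).

Definition ord_lt (a b : Ord) : Prop :=
  exists s t, [/\ ord_class a s, ord_class b t & preord_lt s t].

Definition ord_le (a b : Ord) : Prop := ord_lt a b \/ a = b.

Definition ord_zero : Ord :=
  ord_of (Sup (fun x : False => match x with end)).

Definition ord_succ (a : Ord) : Ord :=
  ord_of (Sup (fun _ : unit => ord_repr a)).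

Definition ord_limit (a : Ord) : Prop :=
  a <> ord_zero /\ forall b, a <> ord_succ b.

Lemma preord_le_refl t : preord_le t t.
Proof.
elim: t => I f IH i.
by exists i; apply: IH.
Qed.

Lemma preord_le_trans s t u :
  preord_le s t -> preord_le t u -> preord_le s u.
Proof.
elim: s t u => I f IH [J g] [K h] st tu i.
have [j fg] := st i; have [k gh] := tu j.
by exists k; apply: IH fg gh.
Qed.

Lemma preord_lt_le_trans s t u :
  preord_lt s t -> preord_le t u -> preord_lt s u.
Proof.
case: t u => [J g] [K h] [j sg] tu; have [k gh] := tu j.
by exists k; apply: preord_le_trans sg gh.
Qed.

Lemma preord_le_lt_trans s t u :
  preord_le s t -> preord_lt t u -> preord_lt s u.
Proof. by case: u => [K h] st [k th]; exists k; apply: preord_le_trans st th. Qed.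

Lemma preord_leP s t :
  preord_le s t <-> (forall u, preord_lt u s -> preord_lt u t).
Proof.
split=> [st u us|]; first exact: preord_lt_le_trans us st.
case: s t => [I f] [J g] H i; apply: (H (f i)).
by exists i; apply: preord_le_refl.
Qed.

Lemma preord_lt_le s t : preord_lt s t -> preord_le s t.
Proof.
elim: s t => I f IH t st; apply/preord_leP => u [i ui].
apply: preord_le_lt_trans ui _; case: t st => [J g] [j sg].
by exists j; apply: IH; apply: preord_lt_le_trans sg; exists i;
  apply: preord_le_refl.
Qed.

Lemma preord_total s t : preord_le s t \/ preord_lt t s.
Proof.
elim: s t => I f IH [J g].
have [[i H]|nH] := pselect (exists i, preord_le (Sup g) (f i)).
  by right; exists i.
left=> i; apply: contrapT => nG; apply: nH; exists i.
apply/preord_leP => u [j uj]; have [fg|gf] := IH i (g j).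
  by case: nG; exists j.
exact: preord_le_lt_trans uj gf.
Qed.

Lemma preord_lt_wf : well_founded preord_lt.
Proof.
suff H t s : preord_le s t -> Acc preord_lt s.
  by move=> t; apply: (H t); apply: preord_le_refl.
elim: t s => J g IH s st; constructor=> u us.
by have [j ug] := preord_lt_le_trans us st; apply: IH ug.
Qed.

Lemma preord_eqv_class s t : preord_eqv s t -> preord_eqv s = preord_eqv t.
Proof.
move=> [st ts]; apply/funext => u; apply/propext; split=> -[? ?]; split;
  by [apply: preord_le_trans st _ | apply: preord_le_trans ts _
     |apply: preord_le_trans _ st | apply: preord_le_trans _ ts].
Qed.

Lemma ord_eq (a b : Ord) : ord_class a = ord_class b -> a = b.
Proof.
case: a b => [C hC] [D hD] /= CD; case: D / CD hD => hD.
by congr MkOrd; apply: Prop_irrelevance.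
Qed.

Lemma ord_reprK a : ord_of (ord_repr a) = a.
Proof. by apply: ord_eq; rewrite /ord_repr; case: cid => t /=. Qed.

Lemma ord_ofP (P : Ord -> Prop) : (forall t, P (ord_of t)) -> forall a, P a.
Proof. by move=> H a; rewrite -(ord_reprK a). Qed.

Lemma ord_lt_of s t : ord_lt (ord_of s) (ord_of t) <-> preord_lt s t.
Proof.
split=> [[s' [t' [/= [ss' _] [_ t't] lt']]]|st].
  by apply: preord_lt_le_trans t't; apply: preord_le_lt_trans ss' lt'.
by exists s, t; split=> //; split; apply: preord_le_refl.
Qed.

Lemma ord_lt_wf : well_founded ord_lt.
Proof.
apply: ord_ofP; apply: (well_founded_ind preord_lt_wf) => t IH.
constructor; apply: ord_ofP => s /ord_lt_of; exact: IH.
Qed.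

Lemma ord_lt_irr a : ~ ord_lt a a.
Proof. by elim/(well_founded_ind ord_lt_wf): a => a IH aa; apply: IH (aa). Qed.

Lemma ord_lt_trans a b c : ord_lt a b -> ord_lt b c -> ord_lt a c.
Proof.
elim/ord_ofP: a => s; elim/ord_ofP: b => t; elim/ord_ofP: c => u.
rewrite !ord_lt_of => st; apply: preord_le_lt_trans; exact: preord_lt_le.
Qed.

Lemma ord_lt_total a b : [\/ ord_lt a b, a = b | ord_lt b a].
Proof.
elim/ord_ofP: a => s; elim/ord_ofP: b => t.
have [st|ts] := preord_total s t; last by apply: Or33; apply/ord_lt_of.
have [ts|st'] := preord_total t s; last by apply: Or31; apply/ord_lt_of.
by apply: Or32; apply: ord_eq; apply: preord_eqv_class.
Qed.

Lemma ord_zero_le a : ord_le ord_zero a.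
Proof.
have [| |] := ord_lt_total ord_zero a; [by left|by right|].
by elim/ord_ofP: a => s /ord_lt_of [].
Qed.

Lemma ord_lt_succ a b : ord_lt b (ord_succ a) <-> ord_le b a.
Proof.
rewrite /ord_succ -{2}(ord_reprK a); elim/ord_ofP: b => s.
set t := ord_repr a; rewrite ord_lt_of; split=> [[_ st]|].
  have [ts|] := preord_total t s; last by left; apply/ord_lt_of.
  by right; apply: ord_eq; apply: preord_eqv_class.
case=> [/ord_lt_of st|st]; exists tt; first exact: preord_lt_le.
have [//|ts] := preord_total s t.
by have /ord_lt_of := ts; rewrite st => /ord_lt_irr.
Qed.

Lemma ord_succ_inj : injective ord_succ.
Proof.
move=> a b ab; have [lt_ab|//|lt_ba] := ord_lt_total a b.
  have /ord_lt_succ [/(ord_lt_trans lt_ab)/ord_lt_irr //|//] :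
    ord_lt b (ord_succ a) by rewrite ab ord_lt_succ; right.
have /ord_lt_succ [/(ord_lt_trans lt_ba)/ord_lt_irr //|//] :
  ord_lt a (ord_succ b) by rewrite -ab ord_lt_succ; right.
Qed.

Lemma ord_bounded (I : Type) (g : I -> Ord) :
  exists b, forall i, ord_lt (g i) b.
Proof.
exists (ord_of (Sup (fun i => ord_repr (g i)))) => i.
rewrite -(ord_reprK (g i)); apply/ord_lt_of; exists i.
exact: preord_le_refl.
Qed.

(** * Ordinals extended by a top symbol: [None] stands for infinity *)

Definition xord_le (x y : option Ord) : Prop :=
  match x, y with
  | _, None => True
  | None, Some _ => False
  | Some a, Some b => ord_le a b
  end.

(** * Discrete valuation rings *)

Section Ring.
Variable R : idomainType.

Definition is_ideal (I : set R) : Prop :=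
  [/\ I 0, forall x y, I x -> I y -> I (x + y) & forall r x, I x -> I (r * x)].

Definition principal_ideal (r : R) : set R := [set x | exists s, x = s * r].

Definition is_maximal_ideal (I : set R) : Prop :=
  [/\ is_ideal I, I <> setT &
      forall J, is_ideal J -> I `<=` J -> J <> setT -> J = I].

Definition is_dvr : Prop :=
  (forall I, is_ideal I -> exists r, I = principal_ideal r) /\
  (exists m, [/\ is_maximal_ideal m, m <> [set 0] &
                 forall m', is_maximal_ideal m' -> m' = m]).

End Ring.

(** * Modules *)

Section Module.
Variables (R : idomainType) (A : lmodType R).

Definition is_submodule (N : set A) : Prop :=
  [/\ N 0, forall x y, N x -> N y -> N (x + y)
    & forall (r : R) x, N x -> N (r *: x)].

Definition is_divisible (N : set A) : Prop :=
  forall (r : R) x, r != 0 -> N x -> exists2 y, N y & x = r *: y.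

Definition is_reduced : Prop :=
  forall N : set A, is_submodule N -> is_divisible N -> N = [set 0].

Definition is_torsion : Prop :=
  forall x : A, exists2 r : R, r != 0 & r *: x = 0.

Definition is_countably_generated : Prop :=
  exists S : set A, countable S /\
    forall N, is_submodule N -> S `<=` N -> N = setT.

(** The elements [x i] of [M] map to a basis of [M / N] over the residue field
    [R / pR]; a scalar [c] vanishes in that field iff it lies in [pR]. *)
Definition is_residue_basis (p : R) (M N : set A) n (x : 'I_n -> A) : Prop :=
  [/\ forall i, M (x i),
      forall c : 'I_n -> R, N (\sum_(i < n) c i *: x i) ->
        forall i, principal_ideal p (c i)
    & forall y, M y -> exists c : 'I_n -> R, N (y - \sum_(i < n) c i *: x i)].

(** Dimension of [M / N] over [R / pR]; [None] if there is no finite basis.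
    When [A] is countably generated, so is [M] (as [R] is noetherian), and the
    only infinite value is then countable infinity. *)
Definition residue_dim (p : R) (M N : set A) : option nat :=
  if pselect (exists n (x : 'I_n -> A), is_residue_basis p M N x) is left ex
  then Some (projT1 (cid ex)) else None.

Definition ulm_step (p : R) (a : Ord) (rec : forall b, ord_lt b a -> set A) :
    set A :=
  [set x | (forall b (lt_ba : ord_lt b a), a = ord_succ b ->
              exists2 y, rec b lt_ba y & x = p *: y) /\
           (ord_limit a -> forall b (lt_ba : ord_lt b a), rec b lt_ba x)].

(** The submodule [A_a], by transfinite recursion on [a]; see
    [ulm_filtration0], [ulm_filtrationS] and [ulm_filtration_lim] below. *)
Definition ulm_filtration (p : R) : Ord -> set A :=
  Fix ord_lt_wf (fun _ => set A) (@ulm_step p).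

Definition socle (p : R) : set A := [set x | p *: x = 0].

Definition socle_filtration (p : R) (a : Ord) : set A :=
  socle p `&` ulm_filtration p a.

Definition ulm_invariant (p : R) (a : Ord) : option nat :=
  residue_dim p (socle_filtration p a) (socle_filtration p (ord_succ a)).

Definition has_height (p : R) (x : A) (a : Ord) : Prop :=
  ulm_filtration p a x /\ ~ ulm_filtration p (ord_succ a) x.

(** An [a] with [has_height p x a] is unique, and exists for every nonzero [x]
    if [A] is reduced and [p] generates the maximal ideal of a discrete
    valuation ring; there is none for [x = 0], whose height is infinity. *)
Definition height (p : R) (x : A) : option Ord :=
  if pselect (exists a, has_height p x a) is left ex
  then Some (projT1 (cid ex)) else None.

Definition ulm_sequence (p : R) (x : A) : nat -> option Ord :=
  fun i => height p (p ^+ i *: x).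

Definition aut_orbit (x : A) : set A :=
  [set y | exists phi : {linear A -> A}, bijective phi /\ phi x = y].

Definition degenerates_to (x y : A) : Prop :=
  exists phi : {linear A -> A}, phi x = y.

Definition orbits : Type := {O : set A | exists x, O = aut_orbit x}.

Definition orbit_of (x : A) : orbits := exist _ (aut_orbit x) (ex_intro _ x erefl).

Definition orbit_le (O O' : orbits) : Prop :=
  exists x y, [/\ O = orbit_of y, O' = orbit_of x & degenerates_to x y].

Lemma ulm_filtrationE p a :
  ulm_filtration p a = ulm_step p (fun b (_ : ord_lt b a) => ulm_filtration p b).
Proof.
rewrite /ulm_filtration Fix_eq // => b f g fg.
by congr ulm_step; apply: functional_extensionality_dep => c;
  apply/funext => lt_cb; exact: fg.
Qed.

Lemma ulm_filtration0 p : ulm_filtration p ord_zero = setT.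
Proof.
rewrite ulm_filtrationE; apply/seteqP; split=> // x _; split=> [b lt_b0|[]//].
have [/(ord_lt_trans lt_b0)|<-] := ord_zero_le b; first by move/ord_lt_irr.
by move=> e; case: (@ord_lt_irr ord_zero); rewrite {2}e ord_lt_succ; right.
Qed.

Lemma ulm_filtrationS p a :
  ulm_filtration p (ord_succ a) = [set p *: y | y in ulm_filtration p a].
Proof.
rewrite ulm_filtrationE; apply/seteqP; split=> x.
  case=> [H _]; have lt_aa : ord_lt a (ord_succ a) by rewrite ord_lt_succ; right.
  by have [y Ay ->] := H a lt_aa erefl; exists y.
move=> [y Ay <-]; split=> [b _ /ord_succ_inj <-|[_ /(_ a)] //]; by exists y.
Qed.

Lemma ulm_filtration_lim p a : ord_limit a ->
  ulm_filtration p a = [set x | forall b, ord_lt b a -> ulm_filtration p b x].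
Proof.
move=> lim_a; rewrite ulm_filtrationE; apply/seteqP; split=> x.
  by case=> [_ H] b lt_ba; exact: (H lim_a b lt_ba).
move=> H; split=> [b lt_ba e|_ b lt_ba]; last exact: (H b lt_ba).
by case: lim_a => _ /(_ b).
Qed.

Lemma ulm_filtration_anti p a b : ord_le a b ->
  ulm_filtration p b `<=` ulm_filtration p a.
Proof.
suff [_] : is_submodule (ulm_filtration p b) /\
    forall a, ord_le a b -> ulm_filtration p b `<=` ulm_filtration p a by apply.
elim/(well_founded_ind ord_lt_wf): b {a} => b IH.
have [->|b0] := pselect (b = ord_zero).
  rewrite ulm_filtration0; split=> // a [|->]; last by rewrite ulm_filtration0.
  have [/ord_lt_trans lt0|<- /ord_lt_irr //] := ord_zero_le a.
  by move/lt0/ord_lt_irr.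
have [[c bc]|nsucc] := pselect (exists c, b = ord_succ c); last first.
  have lim_b : ord_limit b by split=> // c e; apply: nsucc; exists c.
  split; last by move=> a [ab x|-> //]; rewrite ulm_filtration_lim //; apply.
  rewrite ulm_filtration_lim //; split=> [c cb|x y Hx Hy c cb|r x Hx c cb];
    have [[h0 hD hZ] _] := IH c cb => //.
    by apply: hD; [apply: Hx|apply: Hy].
  by apply: hZ; apply: Hx.
have cb : ord_lt c b by rewrite bc; apply/ord_lt_succ; right.
have [[h0 hD hZ] H] := IH c cb.
have sub : ulm_filtration p b `<=` ulm_filtration p c.
  by rewrite bc ulm_filtrationS => _ [x Hx <-]; apply: hZ.
split; last first.
  move=> a [|-> //]; rewrite bc ord_lt_succ -bc => /H.
  by apply: subset_trans sub.
rewrite bc ulm_filtrationS; split.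
- by exists 0; rewrite ?scaler0.
- move=> _ _ [x Hx <-] [y Hy <-].
  by exists (x + y); rewrite ?scalerDr //; apply: hD.
- move=> r _ [x Hx <-].
  by exists (r *: x); [exact: hZ|rewrite !scalerA mulrC].
Qed.

Lemma has_height_uniq p x a b : has_height p x a -> has_height p x b -> a = b.
Proof.
suff H c d : has_height p x c -> has_height p x d -> ~ ord_lt c d.
  by move=> ha hb; have [/(H _ _ ha hb)|//|/(H _ _ hb ha)] := ord_lt_total a b.
move=> [_ nxc] [xd _] cd; apply: nxc; apply: ulm_filtration_anti xd.
have [lt|e|] := ord_lt_total (ord_succ c) d; [by left|by right|].
by rewrite ord_lt_succ => -[/(ord_lt_trans cd)|e];
  [|move: cd; rewrite e] => /ord_lt_irr.
Qed.

(** In particular [Ord] is long enough for every module. *)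
Lemma ulm_filtration_stable p : exists a,
  ulm_filtration p (ord_succ a) = ulm_filtration p a.
Proof.
have [b Hb] := ord_bounded (fun x : A => odflt ord_zero (height p x)).
exists b; apply/seteqP; split=> [|x xb].
  by apply: ulm_filtration_anti; left; rewrite ord_lt_succ; right.
apply: contrapT => nx; have := Hb x; rewrite /height.
case: pselect => [ex|[]]; last by exists b.
by case: cid => a /= ha; rewrite (has_height_uniq ha (conj xb nx)) => /ord_lt_irr.
Qed.

End Module.

(** * The poset [H_f] *)

Definition dim_pos (d : option nat) : Prop :=
  match d with Some n => (0 < n)%N | None => True end.

Definition in_H (f : Ord -> option nat) (h : nat -> option Ord) : Prop :=
  (forall n, h n = None) \/
  exists (k : nat) (g : nat -> Ord),
    [/\ forall n, h n = if (n <= k)%N then Some (g n) else None,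
        forall n, (n < k)%N -> ord_lt (g n) (g n.+1),
        dim_pos (f (g k))
      & forall n, (1 <= n <= k)%N ->
          ord_lt (ord_succ (g n.-1)) (g n) -> dim_pos (f (g n.-1))].

Definition H_poset (f : Ord -> option nat) : Type :=
  {h : nat -> option Ord | in_H f h}.

Definition H_le (f : Ord -> option nat) (h h' : H_poset f) : Prop :=
  forall n, xord_le (sval h' n) (sval h n).

(* Main.v *)
From HB Require Import structures.
Require Import Defs.
From mathcomp Require Import all_boot all_algebra.
From mathcomp Require Import boolp classical_sets cardinality.

Local Open Scope ring_scope.

(** Heights are handled through membership in the filtration [A_a]: an
    endomorphism cannot decrease them, so a degeneration of [x] to [y] makes
    the Ulm sequence of [y] termwise at least that of [x], and elements of one
    orbit have the same Ulm sequence.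

    Since [A] is reduced, every nonzero element has a height.  If the height
    jumps by more than one from [x] to [p x], then [p x = p w] with [w] higher
    than [x], and [x - w] is a socle element of the height of [x]; this is why
    the invariant is nonzero before a gap ([height_gap]).  Conversely a sequence
    in [H_f] is realised from its last term backwards, by dividing by [p] and,
    at a gap, adding a socle element ([ulm_sequence_realize]).

    It remains to construct linear maps.  A linear map on [A] is obtained as the union of a countable
    chain of linear maps defined on submodules of finite length.  In such a
    submodule only finitely many heights occur ([finite_length_heights]), so
    every coset has an element of greatest height, and the height of a sum of
    this element and an element of the submodule is the smaller of the two
    heights ([proper_exists], [proper_vle]).  Choosing such an element [x] of a
    new coset with [p x] in the domain, a map that does not decrease heights
    extends by sending [x] to any [z] at least as high as [x] with [p z] the
    image of [p x] ([partial_hom_step]).  Hence [x] degenerates to [y] as soon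
    as the Ulm sequences are in order ([degenerates_of_vle]).

    If the Ulm sequences are equal, the same is done back and forth with
    isomorphisms that preserve heights, following Kaplansky and Mackey.  Now [z]
    must also be of greatest height in its coset modulo the image.  Let [x] have
    height [a], with [p x] as high as possible.  If [p x] has height [a + 1],
    any [z] as before works ([partial_iso_step]); otherwise the problem reduces
    to finding a socle element of height [a] that is as high as any element of
    its coset modulo the image, knowing that one exists modulo the domain.  This
    is a dimension count over the residue field, made possible by finite length
    ([socle_complement]). *)

Section UlmSequences.

Set Implicit Arguments.
Unset Strict Implicit.
Unset Printing Implicit Defensive.
Import GRing.Theory.
Local Open Scope classical_set_scope.

(** * Discrete valuation rings *)

Section DVR.

Variables (R : idomainType) (p : R).
Hypotheses (dvrR : is_dvr R) (p_gen : is_maximal_ideal (principal_ideal p)).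

Lemma principal_ideal_ideal (r : R) : is_ideal (principal_ideal r).
Proof.
split; first by exists 0; rewrite mul0r.
- by move=> _ _ [s ->] [t ->]; exists (s + t); rewrite mulrDl.
- by move=> c _ [s ->]; exists (c * s); rewrite mulrA.
Qed.

Lemma ideal_one (I : set R) : is_ideal I -> I 1 -> I = setT.
Proof.
by move=> [_ _ IM] I1; apply/seteqP; split=> // x _; rewrite -(mulr1 x); apply: IM.
Qed.

Lemma uniformizer_neq0 : p != 0.
Proof.
case: dvrR => _ [m [_ m0 uniq]]; apply/eqP => p0; apply: m0.
rewrite -(uniq _ p_gen) p0; apply/seteqP; split=> x.
  by move=> [s ->]; rewrite mulr0.
by move=> ->; exists 0; rewrite mulr0.
Qed.

Lemma uniformizer_nonunit : ~ principal_ideal p 1.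
Proof. by case: p_gen => Ip neT _ /(ideal_one Ip). Qed.

(** Any nonunit lies in a maximal ideal, by Zorn's lemma, and there is only
    one maximal ideal. *)
Lemma unit_notin_maximal r : ~ principal_ideal p r -> r \is a GRing.unit.
Proof.
move=> npr; apply: contrapT => nur.
pose good (X : set R) := [/\ is_ideal X, X r & ~ X 1].
have goodr : good (principal_ideal r).
  split; [exact: principal_ideal_ideal|by exists 1; rewrite mul1r|].
  by move=> [s /esym sr]; apply: nur; apply/unitrPr; exists s; rewrite mulrC.
have [F FP Ftot|M [[M0|[IM Mr M1]] Mmax]] :=
  @Zorn_bigcup R (fun X => X = set0 \/ good X).
- have [[X FX [x Xx]]|none] := pselect (exists2 X, F X & X !=set0); last first.
    left; apply/seteqP; split=> // x [X FX Xx].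
    by case: none; exists X => //; exists x.
  right.
  have goodX Y y : F Y -> Y y -> good Y.
    by move=> /FP[->|//].
  have [[X0 _ _] Xr _] := goodX X x FX Xx.
  split; [split| |].
  + by exists X.
  + move=> a b [Y FY Ya] [Z FZ Zb].
    have [YZ|ZY] := Ftot _ _ FY FZ.
      have [[_ ZD _] _ _] := goodX Z b FZ Zb.
      by exists Z => //; apply: ZD => //; apply: YZ.
    have [[_ YD _] _ _] := goodX Y a FY Ya.
    by exists Y => //; apply: YD => //; apply: ZY.
  + move=> c a [Y FY Ya]; have [[_ _ YM] _ _] := goodX Y a FY Ya.
    by exists Y => //; apply: YM.
  + by exists X.
  + by move=> [Y FY Y1]; have [] := goodX Y 1 FY Y1.
- case: (Mmax (principal_ideal r)); last by right.
  rewrite M0; split=> // H; have [_ rr _] := goodr; exact: (H r rr).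
- have maxM : is_maximal_ideal M.
    split=> //; first by move=> MT; apply: M1; rewrite MT.
    move=> J IJ MJ JT; apply: contrapT => neMJ; apply: (Mmax J).
      split=> // JM; apply: neMJ; exact/seteqP.
    by right; split; [|exact: MJ|move/(ideal_one IJ)].
  case: dvrR => _ [m [_ _ uniq]].
  by apply: npr; rewrite (uniq _ p_gen) -(uniq _ maxM).
Qed.

Lemma unit_or_multiple r :
  r \is a GRing.unit \/ exists s, r = s * p.
Proof.
have [[s ->]|/unit_notin_maximal] := pselect (principal_ideal p r); last by left.
by right; exists s.
Qed.

(** The intersection of the ideals generated by the powers of [p] is
    principal and equal to its own product with [p], hence it is zero. *)
Lemma uniformizer_power_unit r : r != 0 ->
  exists n u, u \is a GRing.unit /\ r = u * p ^+ n.
Proof.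
move=> r0; apply: contrapT => none.
have rI n : principal_ideal (p ^+ n) r.
  elim: n => [|n [s rs]]; first by exists r; rewrite expr0 mulr1.
  have [us|[t st]] := unit_or_multiple s; first by case: none; exists n, s.
  by exists t; rewrite rs st exprS mulrA.
pose I : set R := [set x | forall n, principal_ideal (p ^+ n) x].
have II : is_ideal I.
  split=> [n|x y Ix Iy n|c x Ix n]; have [h0 hD hM] := principal_ideal_ideal (p ^+ n).
  - exact: h0.
  - by apply: hD.
  - by apply: hM.
have [d Id] := proj1 dvrR I II.
have dI : I d by rewrite Id; exists 1; rewrite mul1r.
have [e de] := dI 1%N; rewrite expr1 in de.
have [c ec] : principal_ideal d e.
  rewrite -Id => n; have [t dt] := dI n.+1; exists t.
  by apply: (mulIf uniformizer_neq0); rewrite -de dt exprSr mulrA.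
have [t rt] : principal_ideal d r by rewrite -Id.
have d0 : d != 0 by apply: contra r0; rewrite rt => /eqP->; rewrite mulr0.
apply: uniformizer_nonunit; exists c; apply: (mulIf d0).
by rewrite mul1r {1}de ec mulrAC.
Qed.

End DVR.

(** * Ordinals and heights *)

Section Heights.

Lemma ord_le_refl a : ord_le a a.
Proof. by right. Qed.

Lemma ord_lt_succ_refl a : ord_lt a (ord_succ a).
Proof. exact/ord_lt_succ/ord_le_refl. Qed.

Lemma ord_le_trans a b c : ord_le a b -> ord_le b c -> ord_le a c.
Proof. by move=> [ab|->] // [bc|<-]; left=> //; apply: ord_lt_trans ab bc. Qed.

Lemma ord_succ_le a b : ord_lt a b -> ord_le (ord_succ a) b.
Proof.
move=> ab; have [h|h|] := ord_lt_total (ord_succ a) b; [by left|by right|].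
by move=> /ord_lt_succ[/(ord_lt_trans ab)|ba]; [|move: ab; rewrite ba] => /ord_lt_irr.
Qed.

Lemma ord_le_or_succ_le a b : ord_le a b \/ ord_le (ord_succ b) a.
Proof.
have [h|h|/ord_succ_le h] := ord_lt_total a b; [by left; left|by left; right|].
by right.
Qed.

Lemma ord_le_antisym a b : ord_le a b -> ord_le b a -> a = b.
Proof. by move=> [ab|//] [/(ord_lt_trans ab)/ord_lt_irr//|->]. Qed.

Lemma xord_le_antisym x y : xord_le x y -> xord_le y x -> x = y.
Proof.
by case: x y => [a|] [b|] //= ab ba; congr Some; apply: ord_le_antisym.
Qed.

Variables (R : idomainType) (p : R) (A : lmodType R).
Hypothesis (p_gen : is_maximal_ideal (principal_ideal p)).
Implicit Types (x y : A) (a b : Ord).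
Local Notation F := (@ulm_filtration R A p).

Lemma ulm_filtration_submodule a : is_submodule (F a).
Proof.
elim/(well_founded_ind ord_lt_wf): a => a IH.
have [->|a0] := pselect (a = ord_zero); first by rewrite ulm_filtration0.
have [[c ac]|nsucc] := pselect (exists c, a = ord_succ c).
  have [|h0 hD hZ] := IH c; first by rewrite ac; apply: ord_lt_succ_refl.
  rewrite ac ulm_filtrationS; split.
  - by exists 0; rewrite ?scaler0.
  - move=> _ _ [x Hx <-] [y Hy <-].
    by exists (x + y); rewrite ?scalerDr //; apply: hD.
  - move=> r _ [x Hx <-].
    by exists (r *: x); [exact: hZ|rewrite !scalerA mulrC].
have lim_a : ord_limit a by split=> // c e; apply: nsucc; exists c.
rewrite ulm_filtration_lim //; split=> [c ca|x y Hx Hy c ca|r x Hx c ca];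
  have [h0 hD hZ] := IH c ca => //.
- by apply: hD; [apply: Hx|apply: Hy].
- by apply: hZ; apply: Hx.
Qed.

Lemma filtr0 a : F a 0.
Proof. by case: (ulm_filtration_submodule a). Qed.

Lemma filtrD a x y : F a x -> F a y -> F a (x + y).
Proof. by case: (ulm_filtration_submodule a) => _ D _; apply: D. Qed.

Lemma filtrZ a r x : F a x -> F a (r *: x).
Proof. by case: (ulm_filtration_submodule a) => _ _ Z; apply: Z. Qed.

Lemma filtrN a x : F a x -> F a (- x).
Proof. by move=> Fx; rewrite -scaleN1r; apply: filtrZ. Qed.

Lemma filtrB a x y : F a x -> F a y -> F a (x - y).
Proof. by move=> Fx Fy; apply: filtrD => //; apply: filtrN. Qed.

Lemma filtrDl a x y : F a y -> F a (x + y) -> F a x.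
Proof. by move=> Fy Fxy; rewrite -(addrK y x); apply: filtrB. Qed.

Lemma filtr_succ a x : F a x -> F (ord_succ a) (p *: x).
Proof. by move=> Fx; rewrite ulm_filtrationS; exists x. Qed.

Lemma filtr_succP a x : F (ord_succ a) x -> exists2 y, F a y & x = p *: y.
Proof. by rewrite ulm_filtrationS => -[y Fy <-]; exists y. Qed.

Lemma filtr_le a b x : ord_le a b -> F b x -> F a x.
Proof. by move=> /ulm_filtration_anti; apply. Qed.

Lemma filtrZ_unit a u x : u \is a GRing.unit -> F a (u *: x) -> F a x.
Proof. by move=> uu /(filtrZ u^-1); rewrite scalerA mulVr // scale1r. Qed.

Lemma filtr_height_le a b x : F b x -> has_height p x a -> ord_le b a.
Proof.
move=> Fx [_ nFx]; have [//|h] := ord_le_or_succ_le b a.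
by case: nFx; apply: filtr_le Fx.
Qed.

(** A module endomorphism does not decrease heights. *)
Lemma filtr_linear (phi : {linear A -> A}) a x : F a x -> F a (phi x).
Proof.
elim/(well_founded_ind ord_lt_wf): a x => a IH x.
have [->|a0] := pselect (a = ord_zero); first by rewrite ulm_filtration0.
have [[c ac]|nsucc] := pselect (exists c, a = ord_succ c).
  rewrite ac; move=> /filtr_succP[y Fy ->]; rewrite linearZ /=; apply: filtr_succ.
  by apply: IH (Fy); rewrite ac; apply: ord_lt_succ_refl.
have lim_a : ord_limit a by split=> // c e; apply: nsucc; exists c.
by rewrite !ulm_filtration_lim // => Fx b ba; apply: IH (ba) _ (Fx b ba).
Qed.

(** [vle x y] says that the height of [x] is at most that of [y], and
    [veq x y] that the two heights agree; both are phrased through membership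
    in the filtration, so that [0], whose height is infinity, needs no
    separate treatment. *)
Definition vle x y := forall a, F a x -> F a y.
Definition veq x y := vle x y /\ vle y x.

Lemma vle_total x y : vle x y \/ vle y x.
Proof.
have [|nxy] := pselect (vle x y); [by left|right=> b Fby].
have /existsNP[a nH] := nxy.
have /not_implyP[Fax nFay] := nH.
have [ab|ba] := ord_le_or_succ_le a b; first by case: nFay; apply: filtr_le Fby.
by apply: filtr_le Fax; apply: ord_le_trans ba; left; apply: ord_lt_succ_refl.
Qed.

Lemma vle_trans x y z : vle x y -> vle y z -> vle x z.
Proof. by move=> xy yz a /xy/yz. Qed.

Lemma vle_sub x y z : vle z x -> vle z y -> vle z (x - y).
Proof. by move=> zx zy a Fz; apply: filtrB; [apply: zx|apply: zy]. Qed.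

(** The height of a difference is the smaller one, if the heights differ. *)
Lemma veq_sub x y : vle x y -> ~ vle y x -> veq (x - y) x.
Proof.
move=> xy nyx; split; last by apply: vle_sub.
have /existsNP[a nH] := nyx.
have /not_implyP[Fay nFax] := nH.
move=> b Fb; have [ba|/(ord_le_trans _) ab] := ord_le_or_succ_le b a.
  by rewrite -(subrK y x); apply: filtrD => //; apply: filtr_le Fay.
case: nFax; rewrite -(subrK y x); apply: filtrD => //; apply: filtr_le Fb.
by apply: ab; left; apply: ord_lt_succ_refl.
Qed.

Lemma vleZ_unit u x y : u \is a GRing.unit -> vle x y -> vle (u *: x) (u *: y).
Proof. by move=> uu xy a /(filtrZ_unit uu)/xy; apply: filtrZ. Qed.

Lemma has_height_height x a : has_height p x a -> height p x = Some a.
Proof.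
move=> hx; rewrite /height; case: pselect => [ex|[]]; last by exists a.
by case: cid => b hb /=; rewrite (has_height_uniq hb hx).
Qed.

Lemma height_has_height x a : height p x = Some a -> has_height p x a.
Proof.
by rewrite /height; case: pselect => // ex; case: cid => b hb [<-].
Qed.

Lemma height0 : height p (0 : A) = None.
Proof.
rewrite /height; case: pselect => // -[a [_ []]]; exact: filtr0.
Qed.

(** The invariant at [a] is nonzero exactly when some socle element has
    height [a]. *)
Lemma ulm_invariant_pos a :
  dim_pos (ulm_invariant A p a) <-> exists2 x : A, p *: x = 0 & has_height p x a.
Proof.
rewrite /ulm_invariant /residue_dim; case: pselect => [ex|nex] /=; last first.
  split=> // _; apply: contrapT => none; apply: nex.
  have z : 'I_0 -> A by case.
  exists 0%N, z; split=> [[]//|? _ []//|y [py Fy]]; exists (fun=> 0).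
  rewrite big_ord0 subr0; split=> //; apply: contrapT => nFy.
  by apply: none; exists y.
case: cid => n [x [Mx indep span]] /=; split=> [n0|[y py [Fy nFy]]].
  have [px Fx] := Mx (Ordinal n0); exists (x (Ordinal n0)) => //; split=> // FSx.
  (* The first basis vector would be zero in the quotient, while its coordinate
     on itself is [1]. *)
  pose i0 := Ordinal n0.
  suff Nc : (socle_filtration p (ord_succ a) : set A)
      (\sum_(i < n) (i == i0)%:R *: x i).
    exact: (uniformizer_nonunit p_gen (indep _ Nc i0)).
  rewrite (bigD1 i0) //= scale1r big1 ?addr0 // => i /negPf->.
  by rewrite scale0r.
case: n x Mx indep span => // x Mx indep span.
have [c] := span y (conj py Fy).
by rewrite big_ord0 subr0 => -[_ /nFy].
Qed.

End Heights.

(** * The values of the Ulm sequence *)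

Section Values.

Variables (R : idomainType) (p : R) (A : lmodType R).
Hypotheses (dvrR : is_dvr R) (p_gen : is_maximal_ideal (principal_ideal p)).
Hypotheses (A_red : is_reduced A) (A_tors : is_torsion A).
Implicit Types (x y : A) (a b : Ord).
Local Notation F := (@ulm_filtration R A p).
Local Notation vle := (@vle R p A).

(** A term at which the filtration is stationary is divisible. *)
Lemma filtr_all_eq0 x : (forall a, F a x) -> x = 0.
Proof.
have [a stab] := ulm_filtration_stable A p.
have divp n y : F a y -> exists2 z, F a z & y = p ^+ n *: z.
  elim: n y => [|n IH] y Fy; first by exists y; rewrite ?expr0 ?scale1r.
  have [z Fz ->] := IH y Fy; rewrite -stab in Fz.
  by have [w Fw ->] := filtr_succP Fz; exists w; rewrite ?scalerA ?exprSr.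
have FaE : F a = [set 0].
  apply: A_red; first exact: ulm_filtration_submodule.
  move=> r y r0 Fy.
  have [n [u [uu ->]]] := uniformizer_power_unit dvrR p_gen r0.
  have [z Fz ->] := divp n y Fy; exists (u^-1 *: z); first exact: filtrZ.
  by rewrite scalerA mulrAC divrr // mul1r.
by move=> /(_ a); rewrite FaE.
Qed.

Lemma has_height_exists x : x != 0 -> exists a, has_height p x a.
Proof.
move=> x0; apply: contrapT => none; case/eqP: x0; apply: filtr_all_eq0 => a.
elim/(well_founded_ind ord_lt_wf): a => a IH.
have [->|a0] := pselect (a = ord_zero); first by rewrite ulm_filtration0.
have [[c ac]|nsucc] := pselect (exists c, a = ord_succ c).
  rewrite ac; apply: contrapT => nF; apply: none; exists c; split=> //.
  by apply: IH; rewrite ac; apply: ord_lt_succ_refl.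
have lim_a : ord_limit a by split=> // c e; apply: nsucc; exists c.
by rewrite ulm_filtration_lim.
Qed.

Lemma filtr_heightP a x : F a x <-> xord_le (Some a) (height p x).
Proof.
have [->|x0] := eqVneq x 0; first by rewrite height0; split=> // _; apply: filtr0.
have [b hb] := has_height_exists x0; rewrite (has_height_height hb) /=.
split=> [Fx|ab]; first exact: filtr_height_le Fx hb.
by apply: filtr_le ab _; case: hb.
Qed.

Lemma vle_heightP x y : vle x y <-> xord_le (height p x) (height p y).
Proof.
split=> [xy|le a /filtr_heightP ax]; last first.
  apply/filtr_heightP; move: ax le.
  by case: (height p x) (height p y) => [b|] [c|] //=; apply: ord_le_trans.
case hx: (height p x) => [a|].
  by apply/filtr_heightP/xy; case/height_has_height: hx.
have -> : y = 0; last by rewrite height0.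
apply: filtr_all_eq0 => a; apply: xy; apply/filtr_heightP; by rewrite hx.
Qed.

Lemma torsion_power x : exists n, p ^+ n *: x = 0.
Proof.
have [r r0 rx] := A_tors x.
have [n [u [uu ru]]] := uniformizer_power_unit dvrR p_gen r0.
by exists n; rewrite -[LHS]scale1r -(mulVr uu) -scalerA (scalerA u) -ru rx scaler0.
Qed.

Lemma ulm_sequence_vle x y :
  (forall n, xord_le (ulm_sequence p x n) (ulm_sequence p y n)) ->
  forall r, vle (r *: x) (r *: y).
Proof.
move=> le r; have [->|r0] := eqVneq r 0; first by rewrite !scale0r.
have [n [u [uu ->]]] := uniformizer_power_unit dvrR p_gen r0.
by rewrite -!scalerA; apply: vleZ_unit => //; apply/vle_heightP/le.
Qed.

Lemma ulm_sequence_linear (phi : {linear A -> A}) x n :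
  xord_le (ulm_sequence p x n) (ulm_sequence p (phi x) n).
Proof.
apply/vle_heightP => a; rewrite -linearZ; exact: filtr_linear.
Qed.

(** If the height jumps by more than one from [x] to [p *: x], then
    [p *: x = p *: w] with [w] of larger height than [x], and [x - w] has
    order [p] and the height of [x]. *)
Lemma height_gap x a : has_height p x a -> F (ord_succ (ord_succ a)) (p *: x) ->
  dim_pos (ulm_invariant A p a).
Proof.
move=> [Fx nFx] /filtr_succP[w Fw xw]; apply/(ulm_invariant_pos A p_gen).
exists (x - w); first by rewrite scalerBr xw subrr.
split.
  by apply: filtrB => //; apply: filtr_le Fw; left; apply: ord_lt_succ_refl.
by move=> Fxw; apply: nFx; rewrite -(subrK w x); apply: filtrD.
Qed.

Lemma ulm_sequence_in_H x : in_H (ulm_invariant A p) (ulm_sequence p x).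
Proof.
have [->|x0] := eqVneq x 0.
  by left=> n; rewrite /ulm_sequence scaler0 height0.
right; have [m pm] := torsion_power x.
have ex : exists n, p ^+ n *: x == 0 by exists m; apply/eqP.
case: (ex_minnP ex) => -[|k] /eqP pk min.
  by move: x0; rewrite -(scale1r x) -(expr0 p) pk eqxx.
have nz n : (n <= k)%N -> p ^+ n *: x != 0.
  by move=> nk; apply/negP => /min; rewrite ltnNge nk.
have z n : (k < n)%N -> p ^+ n *: x = 0.
  by move=> /subnK <-; rewrite exprD -scalerA pk scaler0.
exists k, (fun n => odflt ord_zero (height p (p ^+ n *: x))).
have hh n : (n <= k)%N ->
    has_height p (p ^+ n *: x) (odflt ord_zero (height p (p ^+ n *: x))).
  by move=> /nz/has_height_exists[a ha]; rewrite (has_height_height ha).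
have pS n : p ^+ n.+1 *: x = p *: (p ^+ n *: x) by rewrite exprS scalerA.
split=> [n|n nk||n /andP[]].
- rewrite /ulm_sequence; case: leqP => [nk|/z->]; last exact: height0.
  by rewrite -(has_height_height (hh n nk)).
- have [Fn _] := hh n (ltnW nk); have := filtr_succ Fn; rewrite -pS.
  move=> /filtr_height_le/(_ (hh n.+1 nk)).
  by case=> [|<-]; [apply: ord_lt_trans|]; apply: ord_lt_succ_refl.
- apply/(ulm_invariant_pos A p_gen); exists (p ^+ k *: x); last exact: hh.
  by rewrite -pS.
- case: n => // n _ nk /= gap; apply: (height_gap (hh n (ltnW nk))).
  by rewrite -pS; have [Fn _] := hh _ nk; apply: filtr_le Fn; apply: ord_succ_le.
Qed.

(** Built from the last term backwards: an element [x'] realising the tail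
    [g 1, ..., g k] is [p *: w] with the height of [w] at least [g 0]; when
    the gap is such that [w] is too high, a socle element of height [g 0] is
    added to it. *)
Lemma ulm_sequence_realize k (g : nat -> Ord) :
  (forall n, (n < k)%N -> ord_lt (g n) (g n.+1)) ->
  dim_pos (ulm_invariant A p (g k)) ->
  (forall n, (n < k)%N -> ord_lt (ord_succ (g n)) (g n.+1) ->
     dim_pos (ulm_invariant A p (g n))) ->
  exists x, (forall n, (n <= k)%N -> has_height p (p ^+ n *: x) (g n)) /\
            p ^+ k.+1 *: x = 0.
Proof.
elim: k g => [|k IH] g incr last gap.
  have /(ulm_invariant_pos A p_gen)[x px hx] := last.
  exists x; rewrite expr1; split=> // n.
  by rewrite leqn0 => /eqP->; rewrite expr0 scale1r.
have [x' [hx' px']] := IH (g \o succn) (fun n => incr n.+1) last (fun n => gap n.+1).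
suff [x hx xx'] : exists2 x, has_height p x (g 0%N) & p *: x = x'.
  exists x; split=> [[_|n nk]|]; first by rewrite expr0 scale1r.
    by rewrite exprSr -scalerA xx'; apply: hx'.
  by rewrite exprSr -scalerA xx'.
have := hx' 0%N isT; rewrite expr0 scale1r /= => hx0.
have [Fx' nFx'] := hx0.
have [jump|g10] := pselect (ord_lt (ord_succ (g 0%N)) (g 1%N)).
  have /(ulm_invariant_pos A p_gen)[z pz [Fz nFz]] := gap 0%N isT jump.
  have /filtr_succP[w Fw x'w] := filtr_le (ord_succ_le jump) Fx'.
  exists (w + z); last by rewrite scalerDr pz addr0.
  split=> [|Fwz]; last by apply: nFz; apply: filtrDl Fw _; rewrite addrC.
  by apply: filtrD => //; apply: filtr_le Fw; left; apply: ord_lt_succ_refl.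
have g1E : g 1%N = ord_succ (g 0%N).
  have [] := ord_succ_le (incr 0%N isT); last by [].
  by move/g10.
have /filtr_succP[w Fw x'w] : @ulm_filtration R A p (ord_succ (g 0%N)) x'.
  by rewrite -g1E.
exists w => //; split=> // /filtr_succ; rewrite -x'w -g1E //.
Qed.

Lemma ulm_sequence_onto h : in_H (ulm_invariant A p) h ->
  exists x, ulm_sequence p x = h.
Proof.
case=> [hN|[k [g [hE incr last gap]]]].
  by exists 0; apply/funext => n; rewrite /ulm_sequence scaler0 height0.
have [x [hx px]] := ulm_sequence_realize incr last (fun n => gap n.+1).
exists x; apply/funext => n; rewrite hE /ulm_sequence.
case: leqP => [nk|/subnK <-]; first exact/has_height_height/hx.
by rewrite exprD -scalerA px scaler0 height0.
Qed.

End Values.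

(** * Submodules of finite length *)

Section FiniteLength.

Section Submodules.
Variables (R : idomainType) (W : lmodType R).
Implicit Types (S : set W) (x : W).

Lemma submoduleN S x : is_submodule S -> S x -> S (- x).
Proof. by move=> [_ _ Z] Sx; rewrite -scaleN1r; apply: Z. Qed.

Lemma submoduleB S x y : is_submodule S -> S x -> S y -> S (x - y).
Proof. by move=> HS Sx Sy; case: (HS) => _ D _; apply: D => //; apply: submoduleN. Qed.

Lemma submodule_sum S n (s : 'I_n -> W) : is_submodule S ->
  (forall i, S (s i)) -> S (\sum_(i < n) s i).
Proof. by move=> [h0 hD _] Ss; elim/big_ind: _. Qed.

(** The submodule generated by the submodule [S] and the element [x]. *)
Definition adjoin S x : set W := [set y | exists s r, S s /\ y = s + r *: x].

Lemma adjoin_submodule S x : is_submodule S -> is_submodule (adjoin S x).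
Proof.
move=> [h0 hD hZ]; split; first by exists 0, 0; rewrite scale0r addr0.
- move=> _ _ [s [r [Ss ->]]] [t [q [St ->]]]; exists (s + t), (r + q).
  by split; [exact: hD|rewrite scalerDl addrACA].
- move=> c _ [s [r [Ss ->]]]; exists (c *: s), (c * r).
  by split; [exact: hZ|rewrite scalerDr scalerA].
Qed.

Lemma sub_adjoin S x : S `<=` adjoin S x.
Proof. by move=> s Ss; exists s, 0; rewrite scale0r addr0. Qed.

Lemma adjoin_mem S x s : S s -> adjoin S x (s + x).
Proof. by move=> Ss; exists s, 1; rewrite scale1r. Qed.

End Submodules.

Variables (R : idomainType) (p : R) (A : lmodType R).
Hypotheses (dvrR : is_dvr R) (p_gen : is_maximal_ideal (principal_ideal p)).
Implicit Types (S X : set A) (x y : A).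
Local Notation F := (@ulm_filtration R A p).
Local Notation vle := (@vle R p A).
Local Notation veq := (@veq R p A).

Lemma adjoin_cases (W : lmodType R) (S : set W) (x y : W) :
  is_submodule S -> S (p *: x) -> adjoin S x y ->
  S y \/ exists2 u, u \is a GRing.unit & exists2 s, S s & y = u *: (s + x).
Proof.
move=> [h0 hD hZ] px [s [r [Ss ->]]].
have [ur|[c ->]] := unit_or_multiple dvrR p_gen r.
  right; exists r => //; exists (r^-1 *: s); first exact: hZ.
  by rewrite scalerDr scalerA divrr // scale1r.
by left; apply: hD => //; rewrite -scalerA; apply: hZ.
Qed.

(** Submodules having a finite chain with quotients that are zero or simple.
    In a torsion module, these are the finitely generated submodules. *)
Inductive finite_length : set A -> Prop :=
| finite_length_zero : finite_length [set 0]
| finite_length_adjoin S x :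
    finite_length S -> S (p *: x) -> finite_length (adjoin S x).

Lemma finite_length_submodule S : finite_length S -> is_submodule S.
Proof.
elim=> [|S' x _ IH _]; last exact: adjoin_submodule.
split=> [//|_ _ -> ->|r _ ->]; first by rewrite addr0.
by rewrite scaler0.
Qed.

(** A step with simple quotient brings at most one new height: if two elements
    of the same coset had different new heights, the smaller one would be the
    height of their difference, which lies in the smaller submodule. *)
Lemma finite_length_heights S : finite_length S ->
  exists n (L : nat -> A), forall s, S s -> exists2 i, (i < n)%N & veq s (L i).
Proof.
elim=> [|{}S x flS [n [L HL]] px].
  by exists 1%N, (fun=> 0) => _ ->; exists 0%N; last split.
have subS := finite_length_submodule flS.
have unitE u y : u \is a GRing.unit -> veq (u *: y) y.
  by move=> uu; split=> a; [apply: filtrZ_unit|apply: filtrZ].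
have reduct n' L' : (forall s, S s -> exists2 i, (i < n')%N & veq s (L' i)) ->
    (forall s, S s -> exists2 i, (i < n')%N & veq (s + x) (L' i)) ->
    forall y, adjoin S x y -> exists2 i, (i < n')%N & veq y (L' i).
  move=> HS Hx y /(adjoin_cases subS px)[/HS//|[u uu [s Ss ->]]].
  have [i ni [h1 h2]] := Hx s Ss; exists i => //.
  have [h3 h4] := unitE u (s + x) uu.
  by split; [apply: vle_trans h1|apply: vle_trans h4].
have [[s0 Ss0 new]|none] := pselect (exists2 s0, S s0 &
    forall i, (i < n)%N -> ~ veq (s0 + x) (L i)); last first.
  exists n, L; apply: reduct => // s Ss; apply: contrapT => nex; apply: none.
  by exists s => // i ni h; apply: nex; exists i.
exists n.+1, (fun i => if i == n then s0 + x else L i).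
have old y : (exists2 i, (i < n)%N & veq y (L i)) ->
    exists2 i, (i < n.+1)%N & veq y (if i == n then s0 + x else L i).
  by move=> [i ni h]; exists i; [apply: ltnW|rewrite ltn_eqF].
apply: reduct => s Ss; first by apply: old; apply: HL.
apply: contrapT => nold.
have key s1 s2 : S s1 -> S s2 -> vle (s1 + x) (s2 + x) ->
    ~ vle (s2 + x) (s1 + x) -> exists2 i, (i < n)%N & veq (s1 + x) (L i).
  move=> S1 S2 le nle; have [h1 h2] := veq_sub le nle.
  have [|i ni [h3 h4]] := HL (s1 + x - (s2 + x)).
    by rewrite opprD addrACA subrr addr0; apply: submoduleB.
  by exists i => //; split; [apply: vle_trans h3|apply: vle_trans h1].
apply: nold; have [le|le] := vle_total p (s + x) (s0 + x).
  have [ge|nge] := pselect (vle (s0 + x) (s + x)); last by apply: old; exact: key nge.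
  by exists n; rewrite ?eqxx //; split.
have [ge|nge] := pselect (vle (s + x) (s0 + x)).
  by exists n; rewrite ?eqxx //; split.
by have [i ni] := key _ _ Ss0 Ss le nge => /(new i ni).
Qed.

Lemma finite_heights_max n (L : nat -> A) X x0 : X x0 ->
  (forall x, X x -> exists2 i, (i < n)%N & veq x (L i)) ->
  exists2 m, X m & forall x, X x -> vle x m.
Proof.
elim: n X x0 => [|n IH] X x0 Xx0 HX; first by have [] := HX x0 Xx0.
have low x : X x -> ~ veq x (L n) -> exists2 i, (i < n)%N & veq x (L i).
  move=> /HX[i]; rewrite ltnS leq_eqVlt => /orP[/eqP->//|ni] h _.
  by exists i.
have [[x1 Xx1 x1n]|none] := pselect (exists2 x, X x & veq x (L n)); last first.
  by apply: IH Xx0 _ => x Xx; apply: low => // h; apply: none; exists x.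
have [[x2 [Xx2 x2n]]|all] := pselect (exists x, X x /\ ~ veq x (L n)); last first.
  exists x1 => // x Xx; have [_ h] := x1n; apply: vle_trans h.
  by apply: contrapT => nh; apply: all; exists x; split=> // -[].
have [||m [Xm mn] mmax] := IH [set x | X x /\ ~ veq x (L n)] x2.
- by split.
- by move=> x [Xx xn]; apply: low.
have lastle x : X x -> veq x (L n) -> vle x x1.
  by move=> Xx [h _]; apply: vle_trans h _; case: x1n.
have [le|le] := vle_total p x1 m.
  exists m => // x Xx; have [/(lastle x Xx) h|xn] := pselect (veq x (L n)).
    exact: vle_trans h le.
  exact: mmax.
exists x1 => // x Xx; have [/(lastle x Xx) //|xn] := pselect (veq x (L n)).
by apply: vle_trans le; apply: mmax.
Qed.

Lemma finite_length_max S X x0 : finite_length S -> X `<=` S -> X x0 ->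
  exists2 m, X m & forall x, X x -> vle x m.
Proof.
move=> /finite_length_heights[n [L HL]] XS Xx0.
by apply: finite_heights_max Xx0 _ => x /XS/HL; apply.
Qed.

(** The dimensions over the residue field of the sections of [S] annihilated
    by [p] are bounded. *)
Lemma finite_length_dependent S : finite_length S ->
  exists n, forall (N : set A) (s : 'I_n.+1 -> A), is_submodule N ->
    (forall i, S (s i)) -> (forall i, N (p *: s i)) ->
    exists c : 'I_n.+1 -> R,
      (exists i, c i \is a GRing.unit) /\ N (\sum_i c i *: s i).
Proof.
elim=> [|{}S x flS [n Hn] px].
  exists 0%N => N s [N0 _ _] Ss _; exists (fun=> 1); split.
    by exists ord0; apply: unitr1.
  by rewrite big1 // => i _; rewrite (Ss i) scaler0.
have subS := finite_length_submodule flS; have [S0 SD SZ] := subS.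
exists n.+1 => N s subN Ss Ns; have [N0 ND NZ] := subN.
have [[j [u uu [s0 Ss0 sj]]]|none] := pselect (exists j, exists2 u,
    u \is a GRing.unit & exists2 s0, S s0 & s j = u *: (s0 + x)); last first.
  have Ss' i : S (s i).
    have [//|[u uu [s0 Ss0 si]]] := adjoin_cases subS px (Ss i).
    by case: none; exists i, u => //; exists s0.
  have [c [[i ci] Nc]] := Hn N (fun i => s (lift ord0 i)) subN
    (fun i => Ss' _) (fun i => Ns _).
  exists (fun i => if unlift ord0 i is Some k then c k else 0); split.
    by exists (lift ord0 i); rewrite liftK.
  rewrite (bigD1_ord ord0) //= unlift_none scale0r add0r.
  by rewrite (eq_bigr (fun i => c i *: s (lift ord0 i))) // => k _; rewrite liftK.
(* The [j]-th element generates the quotient, and is used as a pivot. *)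
have /choice[q Hq] i : exists q, S (s (lift j i) - q *: s j).
  have [s1 [r [Ss1 ->]]] := Ss (lift j i); exists (r * u^-1).
  rewrite sj scalerA mulrVK // scalerDr opprD addrACA subrr addr0.
  by apply: submoduleB => //; apply: SZ.
have Nq i : N (p *: (s (lift j i) - q i *: s j)).
  rewrite scalerBr scalerA mulrC -scalerA.
  by apply: submoduleB => //; apply: NZ.
have [c [[i ci] Nc]] := Hn N _ subN Hq Nq.
exists (fun i => if unlift j i is Some k then c k else - \sum_k c k * q k); split.
  by exists (lift j i); rewrite liftK.
rewrite (bigD1_ord j) //= unlift_none scaleNr scaler_suml addrC.
rewrite (eq_bigr (fun i => c i *: s (lift j i))) => [|k _]; last by rewrite liftK.
rewrite -sumrB (eq_bigr (fun i => c i *: (s (lift j i) - q i *: s j))) // => k _.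
by rewrite scalerBr scalerA.
Qed.

End FiniteLength.

(** * Extending partial homomorphisms *)

Section Extensions.

Variables (R : idomainType) (p : R) (A : lmodType R).
Hypotheses (dvrR : is_dvr R) (p_gen : is_maximal_ideal (principal_ideal p)).
Hypothesis (A_red : is_reduced A).
Implicit Types (S : set A) (G : set (A * A)) (x y z s t : A).
Local Notation F := (@ulm_filtration R A p).
Local Notation vle := (@vle R p A).
Local Notation veq := (@veq R p A).
Local Notation finite_length := (@finite_length R p A).

(** A partial homomorphism is represented by its graph, a submodule of
    [A * A]; [flip] exchanges domain and codomain. *)
Definition dom G : set A := [set x | exists y, G (x, y)].
Definition flip G : set (A * A) := [set u | G (u.2, u.1)].

Lemma dom_adjoin G x z : dom (adjoin G (x, z)) = adjoin (dom G) x.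
Proof.
apply/seteqP; split=> [y [t [[s1 s2] [r [Gs [-> _]]]]]|_ [s [r [[t Gst] ->]]]].
  by exists s1, r; split=> //; exists s2.
by exists (t + r *: z), (s, t), r.
Qed.

Lemma flip_adjoin G x z : flip (adjoin G (x, z)) = adjoin (flip G) (z, x).
Proof.
apply/seteqP; split=> -[y1 y2] [[s1 s2] [r [Gs /= [-> ->]]]];
  by exists (s2, s1), r.
Qed.

Lemma graph_add G s t s' t' : is_submodule G ->
  G (s, t) -> G (s', t') -> G (s + s', t + t').
Proof. by move=> [_ hD _] Gs /(hD _ _ Gs). Qed.

Lemma graph_scale G r s t : is_submodule G -> G (s, t) -> G (r *: s, r *: t).
Proof. by move=> [_ _ hZ] /(hZ r). Qed.

Lemma flip_submodule G : is_submodule G -> is_submodule (flip G).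
Proof.
move=> [h0 hD hZ]; split=> [|[x1 x2] [y1 y2] Gx Gy|r [x1 x2] Gx]; first exact: h0.
  exact: hD Gx Gy.
exact: hZ Gx.
Qed.

Lemma dom0 G : is_submodule G -> dom G 0.
Proof. by move=> [h0 _ _]; exists 0. Qed.

(** A partial homomorphism defined on a submodule of finite length and not
    decreasing heights, which are those in [A].  It is single-valued when [A] is
    reduced, since [0] is then the only element in all terms of the
    filtration. *)
Definition partial_hom G :=
  [/\ is_submodule G, finite_length (dom G) & forall s t, G (s, t) -> vle s t].

(** An isomorphism between submodules of finite length preserving heights; for
    [A] reduced, this property also makes the relation one-to-one. *)
Definition partial_iso G :=
  [/\ is_submodule G, finite_length (dom G), finite_length (dom (flip G))
    & forall s t, G (s, t) -> veq s t].

Lemma partial_iso_flip G : partial_iso G -> partial_iso (flip G).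
Proof.
move=> [subG flG flG' Gv]; split=> //; first exact: flip_submodule.
by move=> s t /Gv[h1 h2]; split.
Qed.

Lemma vle0 x : vle 0 x -> x = 0.
Proof.
move=> h; apply: (filtr_all_eq0 dvrR p_gen A_red) => a; apply: h.
exact: filtr0.
Qed.

(** The height of [s + x] is the smaller of those of [s] and [x], because [x]
    is as high as any element of its coset modulo the domain; nothing is
    assumed on the coset of [z]. *)
Lemma adjoin_vle G x z : is_submodule G ->
  (forall s t, G (s, t) -> vle s t) -> G (p *: x, p *: z) -> vle x z ->
  (forall s, dom G s -> vle (s + x) x) ->
  forall s t, adjoin G (x, z) (s, t) -> vle s t.
Proof.
move=> subG Gv Gp xz prop s t.
move=> /(@adjoin_cases _ _ dvrR p_gen _ G (x, z) _ subG Gp)[/Gv//|].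
move=> [u uu [[s1 t1] Gst [-> ->]]].
apply: vleZ_unit => //= a Fa.
have Fx : F a x by apply: prop Fa; exists t1.
by apply: filtrD; [apply: (Gv _ _ Gst); apply: filtrDl Fx Fa|apply: xz].
Qed.

(** Elements of height [a] that are as high as any element of their coset
    modulo [S] are characterised by this coset avoiding [A_(a + 1)]. *)
Lemma proper_vle S x a : F a x -> (forall s, S s -> ~ F (ord_succ a) (s + x)) ->
  forall s, S s -> vle (s + x) x.
Proof.
move=> Fx prop s Ss b Fb; have [ba|ab] := ord_le_or_succ_le b a.
  exact: filtr_le ba Fx.
by case: (prop s Ss); apply: filtr_le ab Fb.
Qed.

(** Among the elements of greatest height in a coset, one can be taken whose
    multiple by [p] has the greatest height. *)
Lemma proper_exists S y : finite_length S -> S (p *: y) -> ~ S y ->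
  exists s a, let x := s + y in
    [/\ S s, F a x, forall t, S t -> ~ F (ord_succ a) (t + x)
      & forall t, S t -> F a (t + x) -> vle (p *: (t + x)) (p *: x)].
Proof.
move=> flS py nSy; have subS := finite_length_submodule flS.
have [S0 SD SZ] := subS.
have [||_ [s0 Ss0 <-] max0] := @finite_length_max _ p _ dvrR p_gen _
    [set s + y | s in S] (0 + y) (finite_length_adjoin flS py).
- by move=> _ [s Ss <-]; apply: adjoin_mem.
- by exists 0.
have x0 : s0 + y != 0.
  apply/eqP => e; apply: nSy; rewrite -(addKr s0 y) e addr0.
  exact: submoduleN.
have [a [Fa nFa]] := has_height_exists dvrR p_gen A_red x0.
have [||_ [s [Ss Fs] <-] max1] := @finite_length_max _ p _ dvrR p_gen _
  [set p *: (s + y) | s in [set s | S s /\ F a (s + y)]] (p *: (s0 + y)) flS.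
- by move=> _ [s [Ss _] <-]; rewrite scalerDr; apply: SD => //; apply: SZ.
- by exists s0.
exists s, a; split=> // t St; rewrite addrA.
  by move=> Fb; apply: nFa; apply: max0 Fb; exists (t + s) => //; apply: SD.
by move=> Ft; apply: max1; exists (t + s) => //; split=> //; apply: SD.
Qed.

Lemma partial_hom_step G y : partial_hom G -> dom G (p *: y) ->
  exists G', [/\ partial_hom G', G `<=` G' & dom G' y].
Proof.
move=> hG py; have [subG flG Gv] := hG.
have [Gy|nGy] := pselect (dom G y); first by exists G; split=> //.
have subD := finite_length_submodule flG; have [_ SD SZ] := subD.
have [s [a [/= Ss Fx prop _]]] := proper_exists flG py nGy.
set x := s + y in Fx prop.
have px : dom G (p *: x) by rewrite scalerDr; apply: SD => //; apply: SZ.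
have [t Gt] := px.
have /filtr_succP[z Fz tz] : F (ord_succ a) t by apply: (Gv _ _ Gt); apply: filtr_succ.
rewrite tz in Gt.
exists (adjoin G (x, z)); split; last 1 first.
- rewrite dom_adjoin -(addKr s y); apply: adjoin_mem; exact: submoduleN.
- split; first exact: adjoin_submodule.
    by rewrite dom_adjoin; apply: finite_length_adjoin.
  apply: adjoin_vle => //; last exact: proper_vle Fx prop.
  move=> b Fb; have [ba|ab] := ord_le_or_succ_le b a; first exact: filtr_le Fz.
  case: (prop 0); first exact: dom0.
  by rewrite add0r; apply: filtr_le Fb.
- exact: sub_adjoin.
Qed.

Lemma submodule_sum_congr n (c : 'I_n -> R) (f g : 'I_n -> A) a :
  (forall i, F a (f i - g i)) ->
  F a (\sum_i c i *: f i) -> F a (\sum_i c i *: g i).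
Proof.
move=> fg Ff; rewrite -[X in F a X](subKr (\sum_i c i *: f i)); apply: filtrB => //.
rewrite -sumrB; apply: submodule_sum; first exact: ulm_filtration_submodule.
by move=> i; rewrite -scalerBr; apply: filtrZ.
Qed.

(** The counting argument behind Ulm's theorem: the domain and the codomain of
    a height-preserving isomorphism occupy isomorphic, finite-dimensional
    subspaces of the quotient of two successive terms of the filtration of the
    socle, so that one of them is everything only if the other one is.
    Concretely, suppose that every socle element of [A_a] is congruent modulo
    [A_(a + 1)] to an element [t] of the codomain.  The element [s] of the domain
    corresponding to [t] is again congruent to a socle element, to which the
    same applies.  Starting from [x], which is not congruent to any element of
    the domain, this produces infinitely many elements [s] that are independent
    modulo [A_(a + 1)]. *)
Lemma socle_complement G a x : partial_iso G ->
  p *: x = 0 -> F a x -> (forall s, dom G s -> ~ F (ord_succ a) (s + x)) ->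
  exists z, [/\ p *: z = 0, F a z
    & forall t, dom (flip G) t -> ~ F (ord_succ a) (t + z)].
Proof.
move=> [subG flG _ Gv] px Fx prop; apply: contrapT => none.
have [G0 _ GZ] := subG.
have subN := ulm_filtration_submodule p A (ord_succ a).
pose Q y := p *: y = 0 /\ F a y.
have leS : ord_le a (ord_succ a) by left; apply: ord_lt_succ_refl.
have step y : exists u : A * A * A, Q y ->
    [/\ G u.1, F (ord_succ a) (y - u.1.2), Q u.2 & F (ord_succ a) (u.2 - u.1.1)].
  have [[py Fy]|nQ] := pselect (Q y); last by exists (0, 0, 0).
  have [t [s /= Gst] Ft] : exists2 t, dom (flip G) t & F (ord_succ a) (t + y).
    apply: contrapT => nt; apply: none; exists y; split=> // t Gt Ft.
    by apply: nt; exists t.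
  have Fat : F a t by apply: filtrDl Fy _; apply: filtr_le Ft.
  have Fpt : F (ord_succ (ord_succ a)) (p *: t).
    by have := filtr_succ Ft; rewrite scalerDr py addr0.
  have [_ ts] := Gv _ _ Gst; have [_ pts] := Gv _ _ (GZ p _ Gst).
  have [w Fw sw] := filtr_succP (pts _ Fpt).
  exists (- s, - t, w - s) => _; split=> /=.
  - exact: (submoduleN subG Gst).
  - by rewrite opprK addrC.
  - split; first by rewrite scalerBr -sw subrr.
    by apply: filtrB; [apply: filtr_le Fw|apply: ts].
  - by rewrite opprK subrK.
have {step} [f Hf] := choice step.
pose y n := iter n (fun y => (f y).2) x.
have Qy n : Q (y n) by elim: n => [//|n IH] /=; case: (Hf _ IH).
pose s n := (f (y n)).1.1; pose t n := (f (y n)).1.2.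
have Gst n : G (s n, t n).
  by have [+ _ _ _] := Hf _ (Qy n); rewrite /s /t; case: (f (y n)).1.
have yt n : F (ord_succ a) (y n - t n) by have [] := Hf _ (Qy n).
have ys n : F (ord_succ a) (y n.+1 - s n) by have [] := Hf _ (Qy n).
have symN u v : F (ord_succ a) (u - v) -> F (ord_succ a) (v - u).
  by move=> /filtrN; rewrite opprB.
(* A relation among the socle elements from rank [j + 1] on pulls back, through
   the isomorphism, to the same relation from rank [j] on. *)
have Gsum n (c : 'I_n -> R) j :
    G (\sum_i c i *: s (i + j)%N, \sum_i c i *: t (i + j)%N).
  elim: n c j => [|n IH] c j; first by rewrite !big_ord0.
  rewrite !big_ord_recl; apply: (graph_add subG).
    exact: graph_scale.
  have E (u : nat -> A) : \sum_(i < n) c (lift ord0 i) *: u (lift ord0 i + j)%N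
      = \sum_(i < n) c (lift ord0 i) *: u (i + j.+1)%N.
    by apply: eq_bigr => i _; rewrite addnS.
  by rewrite (E s) (E t).
have shift n (c : 'I_n -> R) j : F (ord_succ a) (\sum_i c i *: y (i + j.+1)%N) ->
    F (ord_succ a) (\sum_i c i *: y (i + j)%N).
  move=> H; apply: (@submodule_sum_congr _ _ (fun i => t (i + j)%N)) => [i|].
    exact/symN/yt.
  have [+ _] := Gv _ _ (Gsum n c j); apply.
  apply: submodule_sum_congr H => i; rewrite addnS; exact: ys.
(* Shifted down to rank [0], a relation with [c ord0] a unit would express [x]
   through the domain; otherwise the first term vanishes and can be dropped. *)
have indep n (c : 'I_n -> R) j :
    F (ord_succ a) (\sum_i c i *: y (i + j.+1)%N) ->
    forall i, ~ c i \is a GRing.unit.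
  elim: n c j => [|n IH] c j H; first by case.
  have c0 : ~ c ord0 \is a GRing.unit.
    move=> uc.
    have H0 : F (ord_succ a) (\sum_i c i *: y (i + 0)%N).
      by elim: j.+1 H => // k IHk /shift.
    rewrite big_ord_recl addn0 in H0; set Y := \sum_(i < n) _ in H0.
    have HY : F (ord_succ a) (\sum_(i < n) c (lift ord0 i) *: s (i + 0)%N - Y).
      rewrite -sumrB; apply: submodule_sum => // i; rewrite -scalerBr.
      by apply: filtrZ; apply: symN; apply: ys.
    have := filtrZ (c ord0)^-1 (filtrD HY H0).
    rewrite addrA addrAC subrK addrC scalerDr scalerA mulVr // scale1r addrC.
    apply: prop; exists ((c ord0)^-1 *: \sum_(i < n) c (lift ord0 i) *: t (i + 0)%N).
    exact: graph_scale.
  have [q cq] : exists q, c ord0 = q * p.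
    by have [//|] := unit_or_multiple dvrR p_gen (c ord0).
  move: H; rewrite big_ord_recl cq -scalerA (proj1 (Qy _)) scaler0 add0r => H.
  move=> i; have [->//|[k ->]] : i = ord0 \/ exists k, i = lift ord0 k.
    by case: (unliftP ord0 i) => [k ->|->]; [right; exists k|left].
  apply: (IH (fun i => c (lift ord0 i)) j.+1).
  have E (l : 'I_n) : (lift ord0 l + j.+1 = l + j.+2)%N by rewrite lift0 addSnnS.
  by move: H; under eq_bigr => l _ do rewrite E.
have [n Hn] := finite_length_dependent dvrR p_gen flG.
have [i|i|c [[i ci] Nc]] := Hn _ (fun i => s i) subN.
- by exists (t i).
- apply: filtr_succ; rewrite -(subKr (y i.+1) (s i)); apply: filtrB.
    by case: (Qy i.+1).
  exact: filtr_le leS (ys i).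
- apply: (indep _ c 0%N _ i) => //.
  apply: (submodule_sum_congr _ Nc) => k.
  by rewrite addn1; apply/symN/ys.
Qed.

(** The step of the back-and-forth argument of Kaplansky and Mackey. *)
Lemma partial_iso_step G y : partial_iso G -> dom G (p *: y) ->
  exists G', [/\ partial_iso G', G `<=` G' & dom G' y].
Proof.
move=> hG py; have [subG flG flG' Gv] := hG.
have [Gy|nGy] := pselect (dom G y); first by exists G; split=> //.
have subD := finite_length_submodule flG; have [D0 SD SZ] := subD.
have [s [a [/= Ss Fx prop maxp]]] := proper_exists flG py nGy.
set x := s + y in Fx prop maxp.
have [t Gt] : dom G (p *: x) by rewrite scalerDr; apply: SD => //; apply: SZ.
have leS : ord_le a (ord_succ a) by left; apply: ord_lt_succ_refl.
have [z [zt Fz propz]] : exists z, [/\ p *: z = t, F a z &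
    forall t, dom (flip G) t -> ~ F (ord_succ a) (t + z)].
  have [xt tx] := Gv _ _ Gt.
  have [high|low] := pselect (F (ord_succ (ord_succ a)) (p *: x)).
    (* [p x = p w] with [w] of height greater than [a]: then [x - w] is a socle
       element that is as high as any element of its coset. *)
    have /filtr_succP[w Fw xw] := high.
    have /filtr_succP[v Fv tv] := xt _ high.
    have [||s' Ds' Fs'|z0 [pz0 Fz0 propz0]] := @socle_complement G a (x - w) hG.
    - by rewrite scalerBr xw subrr.
    - by apply: filtrB => //; apply: filtr_le Fw.
    - apply: (prop s' Ds'); apply: filtrDl (filtrN Fw) _.
      by rewrite -addrA.
    exists (z0 + v); split; first by rewrite scalerDr pz0 add0r.
      by apply: filtrD => //; apply: filtr_le Fv.
    move=> t' Dt'; rewrite addrA => Ft'; apply: (propz0 t' Dt').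
    exact: filtrDl Fv Ft'.
  have /filtr_succP[z Fz tz] := xt _ (filtr_succ Fx).
  exists z; split=> // t' [s' Gts'] Ft'; have Gst' : G (s', t') by [].
  (* An element of height greater than [a] in the coset of [z] would yield an
     element of the coset of [x] contradicting the choice of [x]. *)
  have [_ ts'] := Gv _ _ Gst'.
  apply: low; apply: (maxp s'); first by exists t'.
    apply: filtrD => //; apply: ts'; exact: filtrDl Fz (filtr_le leS Ft').
  have Gp : G (p *: (s' + x), p *: (t' + z)).
    rewrite (scalerDr _ s') (scalerDr _ t') -tz.
    by apply: (graph_add subG) => //; apply: graph_scale.
  by have [_] := Gv _ _ Gp; apply; apply: filtr_succ.
have xz : veq x z.
  split=> b Fb; have [ba|ab] := ord_le_or_succ_le b a; try by apply: filtr_le ba _.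
    by case: (prop 0 D0); rewrite add0r; apply: filtr_le Fb.
  case: (propz 0); first by exists 0; case: subG.
  by rewrite add0r; apply: filtr_le Fb.
rewrite -zt in Gt.
exists (adjoin G (x, z)); split; last 1 first.
- rewrite dom_adjoin -(addKr s y); apply: adjoin_mem; exact: submoduleN.
- split; first exact: adjoin_submodule.
  + by rewrite dom_adjoin; apply: finite_length_adjoin => //; exists (p *: z).
  + rewrite flip_adjoin dom_adjoin; apply: finite_length_adjoin => //.
    by exists (p *: x).
  + move=> s1 t1 Gst1; split.
      apply: adjoin_vle Gst1 => //; [by move=> ? ? /Gv[]|by case: xz|].
      exact: proper_vle Fx prop.
    have : adjoin (flip G) (z, x) (t1, s1) by rewrite -flip_adjoin.
    apply: adjoin_vle => //; [exact: flip_submodule|by move=> ? ? /Gv[]|by case: xz|].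
    exact: proper_vle Fz propz.
- exact: sub_adjoin.
Qed.

End Extensions.

(** * Endomorphisms and automorphisms with a prescribed value *)

Section Transitivity.

Variables (R : idomainType) (p : R) (A : lmodType R).
Hypotheses (dvrR : is_dvr R) (p_gen : is_maximal_ideal (principal_ideal p)).
Hypotheses (A_red : is_reduced A) (A_tors : is_torsion A).
Hypothesis (A_cg : is_countably_generated A).
Implicit Types (S : set A) (G : set (A * A)) (x y z s t : A).
Local Notation vle := (@vle R p A).
Local Notation veq := (@veq R p A).
Local Notation finite_length := (@finite_length R p A).

Lemma extend_torsion (P : set (A * A) -> Prop) :
  (forall G, P G -> is_submodule G) ->
  (forall G y, P G -> dom G (p *: y) ->
     exists G', [/\ P G', G `<=` G' & dom G' y]) ->
  forall G y, P G -> exists G', [/\ P G', G `<=` G' & dom G' y].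
Proof.
move=> subP step G y PG; have [n] := torsion_power dvrR p_gen A_tors y.
elim: n G y PG => [|n IH] G y PG.
  by rewrite expr0 scale1r => ->; exists G; split=> //; apply: dom0; apply: subP.
rewrite exprSr -scalerA => /(IH _ _ PG)[G1 [PG1 GG1 G1py]].
have [G2 [PG2 G12 Gy]] := step _ _ PG1 G1py.
by exists G2; split=> // u /GG1/G12.
Qed.

Lemma countable_generators : exists e : nat -> A,
  forall N, is_submodule N -> (forall n, N (e n)) -> N = setT.
Proof.
have [S [/countable_injP[f finj] gen]] := A_cg.
have /choice[e He] n : exists x, forall y, S y -> f y = n -> x = y.
  have [[x Sx fx]|none] := pselect (exists2 x, S x & f x = n).
    exists x => y Sy fy; apply: finj; rewrite ?inE ?fx //.
  by exists 0 => y Sy fy; case: none; exists y.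
by exists e => N subN Ne; apply: gen => // y Sy; rewrite -(He (f y) y).
Qed.

(** The union of a chain of relations satisfying [P], in which the [n]-th
    requirement [Q n] is met at the [n]-th step. *)
Lemma relation_limit (P : set (A * A) -> Prop) (Q : nat -> set (A * A) -> Prop) :
  (forall G, P G -> is_submodule G) ->
  (forall n G, P G -> exists G', [/\ P G', G `<=` G' & Q n G']) ->
  forall G0, P G0 -> exists G, [/\ is_submodule G, G0 `<=` G,
    (forall u, G u -> exists2 G', P G' & G' u)
    & forall n, exists2 G', Q n G' & G' `<=` G].
Proof.
move=> subP step G0 PG0.
have step' (nG : nat * set (A * A)) : exists G', P nG.2 ->
    [/\ P G', nG.2 `<=` G' & Q nG.1 G'].
  have [PG|nP] := pselect (P nG.2); last by exists set0.
  by have [G' HG'] := step nG.1 _ PG; exists G'.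
have {step'} [f Hf] := choice step'.
pose C := fix C n := if n is m.+1 then f (m, C m) else G0.
have PC n : P (C n) by elim: n => [//|n IH] /=; have [] := Hf (n, C n) IH.
have CS n : C n `<=` C n.+1 by have [] := Hf (n, C n) (PC n).
have Cmono m n : (m <= n)%N -> C m `<=` C n.
  by move=> /subnK <-; elim: (n - m)%N => [//|k IH] u /IH; apply: CS.
have [C00 _ _] := subP _ PG0.
exists (\bigcup_n C n); split.
- split; first by exists 0%N.
    move=> u v [m _ Cu] [n _ Cv]; exists (maxn m n) => //.
    have [_ CD _] := subP _ (PC (maxn m n)).
    by apply: CD; [apply: Cmono Cu|apply: Cmono Cv]; rewrite ?leq_maxl ?leq_maxr.
  move=> r u [m _ Cu]; exists m => //.
  by have [_ _ CZ] := subP _ (PC m); apply: CZ.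
- by move=> u G0u; exists 0%N.
- by move=> u [n _ Cu]; exists (C n).
- move=> n; exists (C n.+1); first by have [] := Hf (n, C n) (PC n).
  by move=> u Cu; exists n.+1.
Qed.

Lemma dom_submodule G : is_submodule G -> is_submodule (dom G).
Proof.
move=> subG; split=> [|s t [s' Gs] [t' Gt]|r s [s' Gs]]; first exact: dom0.
  by exists (s' + t'); apply: graph_add.
by exists (r *: s'); apply: graph_scale.
Qed.

Lemma graph_linear G : is_submodule G -> dom G = setT ->
  (forall t, G (0, t) -> t = 0) ->
  exists phi : {linear A -> A}, forall s t, G (s, t) <-> phi s = t.
Proof.
move=> subG GT G0.
have fun_G s t t' : G (s, t) -> G (s, t') -> t = t'.
  move=> Gt Gt'; apply/eqP; rewrite -subr_eq0; apply/eqP; apply: G0.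
  by rewrite -(subrr s); apply: (submoduleB subG Gt Gt').
have /choice[f Gf] s : exists t, G (s, t).
  have : dom G s by rewrite GT.
  by move=> [t Gst]; exists t.
have flin : linear f.
  move=> r s t; apply: fun_G (Gf _) _.
  by apply: graph_add => //; apply: graph_scale.
pose phi : {linear A -> A} := HB.pack f (GRing.isLinear.Build R A A *:%R f flin).
by exists phi => s t; split=> [Gst|<-]; [apply: fun_G (Gf s) Gst|apply: Gf].
Qed.

Lemma finite_length_line x : finite_length [set y | exists r, y = r *: x].
Proof.
have [n] := torsion_power dvrR p_gen A_tors x.
elim: n x => [|n IH] x.
  rewrite expr0 scale1r => ->.
  rewrite (_ : [set y | _] = [set 0]); first exact: finite_length_zero.
  apply/seteqP; split=> [_ [r ->]|_ ->]; first exact: scaler0.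
  by exists 0; rewrite scaler0.
rewrite exprSr -scalerA => /IH flp.
rewrite (_ : [set y | _] = adjoin [set y | exists r, y = r *: (p *: x)] x).
  by apply: finite_length_adjoin => //; exists 1; rewrite scale1r.
apply/seteqP; split=> [_ [r ->]|_ [_ [r [[q ->] ->]]]].
  by exists 0, r; rewrite add0r; split=> //; exists 0; rewrite scale0r.
by exists (q * p + r); rewrite scalerDl scalerA.
Qed.

(** The cyclic submodule generated by the pair [(x, y)]. *)
Definition line x y : set (A * A) := [set u | exists r, u = (r *: x, r *: y)].

Lemma line_submodule x y : is_submodule (line x y).
Proof.
split=> [|_ _ [r ->] [q ->]|q _ [r ->]]; first by exists 0; rewrite !scale0r.
  by exists (r + q); rewrite !scalerDl.
by exists (q * r); rewrite -!scalerA.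
Qed.

Lemma line_flip x y : flip (line x y) = line y x.
Proof. by apply/seteqP; split=> -[u v] [r [/= -> ->]]; exists r. Qed.

Lemma finite_length_dom_line x y : finite_length (dom (line x y)).
Proof.
rewrite (_ : dom _ = [set z | exists r, z = r *: x]); first exact: finite_length_line.
apply/seteqP; split=> [_ [_ [r [-> _]]]|_ [r ->]]; first by exists r.
by exists (r *: y), r.
Qed.

(** [A] is fully transitive. *)
Lemma degenerates_of_vle x y : (forall r, vle (r *: x) (r *: y)) ->
  degenerates_to x y.
Proof.
move=> xy; have [e gen] := countable_generators.
have subP G : @partial_hom R p A G -> is_submodule G by case.
have [||G [subG lineG GP GQ]] := @relation_limit (@partial_hom R p A)
  (fun n G => dom G (e n)) subP _ (line x y).
- move=> n G PG; apply: (extend_torsion subP _ _ PG).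
  by move=> ? ?; apply: partial_hom_step.
- split; [exact: line_submodule|exact: finite_length_dom_line|].
  by move=> _ _ [r [-> ->]]; apply: xy.
have domG : dom G = setT.
  apply: gen => [|n]; first exact: dom_submodule.
  by have [G' [t Gt] sub] := GQ n; exists t; apply: sub.
have G0 t : G (0, t) -> t = 0.
  move=> /GP[G' [_ _ Gv] /Gv]; exact: (vle0 dvrR p_gen A_red).
have [phi Hphi] := graph_linear subG domG G0.
by exists phi; apply/Hphi/lineG; exists 1; rewrite !scale1r.
Qed.

(** [A] is transitive: by going back and forth, the isomorphism between the
    cyclic submodules of [x] and [y] is extended to all of [A]. *)
Lemma aut_orbit_of_veq x y : (forall r, veq (r *: x) (r *: y)) ->
  aut_orbit x y.
Proof.
move=> xy; have [e gen] := countable_generators.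
have subP G : @partial_iso R p A G -> is_submodule G by case.
have ext G z : partial_iso p G -> exists G', [/\ partial_iso p G', G `<=` G' & dom G' z].
  by apply: (extend_torsion subP) => ? ?; apply: partial_iso_step.
have [||G [subG lineG GP GQ]] := @relation_limit (@partial_iso R p A)
  (fun n G => dom G (e n) /\ dom (flip G) (e n)) subP _ (line x y).
- move=> n G PG; have [G1 [PG1 GG1 [t Gt]]] := ext G (e n) PG.
  have [G2 [PG2 G12 Ge]] := ext _ (e n) (partial_iso_flip PG1).
  exists (flip G2); split.
  + exact: partial_iso_flip.
  + by move=> [u v] /GG1 Guv; apply: G12.
  + by split=> //; exists t; apply: G12.
- split.
  + exact: line_submodule.
  + exact: finite_length_dom_line.
  + by rewrite line_flip; apply: finite_length_dom_line.
  + by move=> _ _ [r [-> ->]]; apply: xy.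
have domG : dom G = setT.
  apply: gen => [|n]; first exact: dom_submodule.
  by have [G' [[t Gt] _] sub] := GQ n; exists t; apply: sub.
have subG' := flip_submodule subG.
have codG : dom (flip G) = setT.
  apply: gen => [|n]; first exact: dom_submodule.
  by have [G' [_ [t Gt]] sub] := GQ n; exists t; apply: sub.
have Gv s t : G (s, t) -> veq s t by move=> /GP[G' [_ _ _ Gv] /Gv].
have G0 t : G (0, t) -> t = 0.
  move=> /Gv[h1 h2]; exact: (vle0 dvrR p_gen A_red).
have G0' t : flip G (0, t) -> t = 0.
  move=> /Gv[h1 h2]; exact: (vle0 dvrR p_gen A_red).
have [phi Hphi] := graph_linear subG domG G0.
have [psi Hpsi] := graph_linear subG' codG G0'.
exists phi; split; last by apply/Hphi/lineG; exists 1; rewrite !scale1r.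
exists psi => s; first by apply/Hpsi; apply/Hphi.
by apply/Hphi; apply: (Hpsi s (psi s)).2.
Qed.

Lemma aut_orbit_refl x : aut_orbit x x.
Proof. by exists idfun; split=> //; exists idfun. Qed.

Lemma aut_orbit_trans x y z : aut_orbit x y -> aut_orbit y z -> aut_orbit x z.
Proof.
move=> [phi [bphi <-]] [psi [bpsi <-]].
by exists (psi \o phi); split=> //; apply: bij_comp.
Qed.

Lemma aut_orbit_eq x y :
  aut_orbit x = aut_orbit y <-> ulm_sequence p x = ulm_sequence p y.
Proof.
have seq_le (u v : A) : aut_orbit u v ->
    forall n, xord_le (ulm_sequence p u n) (ulm_sequence p v n).
  move=> [phi [_ <-]] n; exact: (ulm_sequence_linear dvrR p_gen A_red phi u n).
have seq_aut (u v : A) : ulm_sequence p u = ulm_sequence p v -> aut_orbit u v.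
  move=> uv; apply: aut_orbit_of_veq => r.
  split; apply: (ulm_sequence_vle dvrR p_gen A_red) => n; rewrite uv.
    by case: (ulm_sequence p v n) => //= a; apply: ord_le_refl.
  by case: (ulm_sequence p v n) => //= a; apply: ord_le_refl.
split=> xy.
  apply/funext => n; apply: xord_le_antisym; apply: seq_le.
    by rewrite xy; apply: aut_orbit_refl.
  by rewrite -xy; apply: aut_orbit_refl.
by apply/seteqP; split=> z; apply: aut_orbit_trans; apply: seq_aut.
Qed.

End Transitivity.

End UlmSequences.

(** * The isomorphism of posets *)

Theorem theorem16 (R : idomainType) (p : R) (A : lmodType R)
    (dvrR : is_dvr R)
    (p_gen : is_maximal_ideal (principal_ideal p))
    (A_red : is_reduced A)
    (A_cg : is_countably_generated A)
    (A_tors : is_torsion A) :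
  exists F : orbits A -> H_poset (ulm_invariant A p),
    [/\ forall a : A, sval (F (orbit_of a)) = ulm_sequence p a,
        bijective F
      & forall O O' : orbits A, orbit_le O O' <-> H_le (F O) (F O')].
Proof.
have orbit_eq (O O' : orbits A) : sval O = sval O' -> O = O'.
  case: O O' => [O hO] [O' hO'] /= e; case: O' / e hO' => hO'.
  by congr exist; apply: Prop_irrelevance.
have H_eq (h h' : H_poset (ulm_invariant A p)) : sval h = sval h' -> h = h'.
  case: h h' => [h hh] [h' hh'] /= e; case: h' / e hh' => hh'.
  by congr exist; apply: Prop_irrelevance.
have orbitE := aut_orbit_eq dvrR p_gen A_red A_tors A_cg.
have repr (O : orbits A) : {x | O = orbit_of x}.
  by apply: cid; case: (svalP O) => x Ox; exists x; apply: orbit_eq.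
pose F (O : orbits A) : H_poset (ulm_invariant A p) :=
  exist _ _ (ulm_sequence_in_H dvrR p_gen A_red A_tors (projT1 (repr O))).
have FE x : sval (F (orbit_of x)) = ulm_sequence p x.
  by apply/orbitE; case: (repr _) => y /= [].
exists F; split=> // [|O O'].
  pose inv (h : H_poset (ulm_invariant A p)) : orbits A :=
    orbit_of (projT1 (cid (ulm_sequence_onto p_gen (svalP h)))).
  have FK h : F (inv h) = h by apply: H_eq; rewrite FE; case: cid.
  exists inv => // O; have [x ->] := repr O.
  apply: orbit_eq; have [y yE] := repr (inv (F (orbit_of x))).
  by rewrite yE; apply/orbitE; rewrite -!FE -yE FK.
split=> [[x [y [-> -> [phi <-]]]] n|].
  by rewrite !FE; apply: (ulm_sequence_linear dvrR p_gen A_red phi x n).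
have [y ->] := repr O; have [x ->] := repr O' => le.
exists x, y; split=> //; apply: (degenerates_of_vle (p := p)) => //.
by apply: ulm_sequence_vle => // n; have := le n; rewrite !FE.
Qed.
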